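(* For $k \in \mathbb{Z}$ let $H_k = \mathbb{Z}^2 \rtimes G_2$, where $G_2 = \langle a, b \mid aba^{-1}b \rangle$ and the generators $a$ and $b$ act on $\mathbb{Z}^2$ by multiplication by the matrices $A = \begin{pmatrix} 0 & 1 \\ 1 & 0 \end{pmatrix}$ and $B_k = \begin{pmatrix} 0 & 1 \\ -1 & k \end{pmatrix}$, respectively. Then among the groups $H_k$ ($k \in \mathbb{Z}$) there are infinitely many that are pairwise non-isomorphic.
   Context: Elements of $\mathbb{Z}^2$ are viewed as column vectors. Since $A, B_k \in \mathrm{GL}_2(\mathbb{Z})$ and $A B_k A^{-1} B_k = I_2$, the assignment $a \mapsto A$, $b \mapsto B_k$ defines an action of $G_2$ on $\mathbb{Z}^2$; in the semidirect product $H_k$, $G_2$ acts on $\mathbb{Z}^2$ by conjugation via this action. *)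

(* Defs.v *)
From HB Require Import structures.
From mathcomp Require Import all_boot all_order all_algebra.
From mathcomp Require Import boolp classical_sets cardinality.

Set Implicit Arguments.
Unset Strict Implicit.
Unset Printing Implicit Defensive.

Import GRing.Theory.

Local Open Scope quotient_scope.
Local Open Scope group_scope.

(* The letter [(s, false)] stands for the generator [s], and [(s, true)] for
   its formal inverse. *)
Definition word (S : choiceType) := seq (S * bool).

Definition inv_letter (S : choiceType) (l : S * bool) := (l.1, ~~ l.2).

Definition inv_word (S : choiceType) (w : word S) : word S :=
  rev (map (@inv_letter S) w).

(* [pres_eq R u v]: [u] and [v] represent the same element of < S | R >.  It is
   the least congruence on words which performs free cancellation and kills the
   relators; quotienting by it amounts to quotienting the free group on [S] by
   the normal closure of [R]. *)
Inductive pres_eq (S : choiceType) (R : word S -> Prop) :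
    word S -> word S -> Prop :=
  | pres_eq_refl u : pres_eq R u u
  | pres_eq_sym u v : pres_eq R u v -> pres_eq R v u
  | pres_eq_trans u v w : pres_eq R u v -> pres_eq R v w -> pres_eq R u w
  | pres_eq_cat u u' v v' :
      pres_eq R u u' -> pres_eq R v v' -> pres_eq R (u ++ v) (u' ++ v')
  | pres_eq_cancel l : pres_eq R [:: l; inv_letter l] [::]
  | pres_eq_rel r : R r -> pres_eq R r [::].

Section Presentation.
Variables (S : choiceType) (R : word S -> Prop).

Definition pres_rel : rel (word S) := fun u v => `[< pres_eq R u v >].

Lemma pres_rel_refl : reflexive pres_rel.
Proof. by move=> u; apply/asboolP; apply: pres_eq_refl. Qed.

Lemma pres_rel_sym : symmetric pres_rel.
Proof.
by move=> u v; apply/asboolP/asboolP => h; apply: pres_eq_sym.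
Qed.

Lemma pres_rel_trans : transitive pres_rel.
Proof.
move=> v u w /asboolP huv /asboolP hvw; apply/asboolP.
exact: pres_eq_trans huv hvw.
Qed.

Canonical pres_equiv :=
  EquivRel pres_rel pres_rel_refl pres_rel_sym pres_rel_trans.

Definition pres := {eq_quot pres_equiv}.

HB.instance Definition _ := EqQuotient.on pres.
HB.instance Definition _ := Choice.on pres.

Lemma pres_piP (u v : word S) : (\pi_pres u = \pi_pres v) <-> pres_eq R u v.
Proof. by split=> [/eqmodP/asboolP | h]; last apply/eqmodP/asboolP. Qed.

Lemma pres_repr (u : word S) : pres_eq R (repr (\pi_pres u)) u.
Proof. by apply/pres_piP; rewrite reprK. Qed.

Definition pres_one : pres := \pi_pres [::].
Definition pres_mul (x y : pres) : pres := \pi_pres (repr x ++ repr y).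
Definition pres_inv (x : pres) : pres := \pi_pres (inv_word (repr x)).

Lemma pres_mul_pi u v : pres_mul (\pi_pres u) (\pi_pres v) = \pi_pres (u ++ v).
Proof. by apply/pres_piP/pres_eq_cat; apply: pres_repr. Qed.

Lemma inv_letterK : involutive (@inv_letter S).
Proof. by case=> s b; rewrite /inv_letter /= negbK. Qed.

Lemma inv_wordK : involutive (@inv_word S).
Proof.
by move=> u; rewrite /inv_word map_rev revK mapK //; apply: inv_letterK.
Qed.

Lemma pres_eq_mulwV (w : word S) : pres_eq R (w ++ inv_word w) [::].
Proof.
elim: w => [|l w IHw]; first exact: pres_eq_refl.
rewrite /inv_word /= rev_cons -cats1 -cat_cons catA.
have h1 := pres_eq_cat (pres_eq_refl R [:: l]) IHw.
apply: pres_eq_trans _ (pres_eq_cancel R l).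
exact: (pres_eq_cat h1 (pres_eq_refl R [:: inv_letter l])).
Qed.

Lemma pres_mulA : associative pres_mul.
Proof.
elim/quotW=> u; elim/quotW=> v; elim/quotW=> w.
by rewrite (pres_mul_pi v) (pres_mul_pi u) (pres_mul_pi u) pres_mul_pi catA.
Qed.

Lemma pres_mul1 : left_id pres_one pres_mul.
Proof. by move=> x; rewrite -(reprK x) pres_mul_pi. Qed.

Lemma pres_mulr1 : right_id pres_one pres_mul.
Proof. by move=> x; rewrite -(reprK x) pres_mul_pi cats0. Qed.

Lemma pres_mulV : left_inverse pres_one pres_inv pres_mul.
Proof.
move=> x; rewrite /pres_inv -{2}(reprK x) pres_mul_pi; apply/pres_piP.
by rewrite -{2}(inv_wordK (repr x)); apply: pres_eq_mulwV.
Qed.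

Lemma pres_mulrV : right_inverse pres_one pres_inv pres_mul.
Proof.
move=> x; rewrite /pres_inv -{1}(reprK x) pres_mul_pi; apply/pres_piP.
exact: pres_eq_mulwV.
Qed.

HB.instance Definition _ := isGroup.Build pres
  pres_mulA pres_mul1 pres_mulr1 pres_mulV pres_mulrV.

Definition pres_gen (s : S) : pres := \pi_pres [:: (s, false)].

Section Lift.
Variables (H : groupType) (f : S -> H).

Definition eval_letter (l : S * bool) : H :=
  if l.2 then (f l.1)^-1 else f l.1.

Definition eval_word (w : word S) : H := \prod_(l <- w) eval_letter l.

(* The map < S | R > -> H extending [f]; it is only meaningful when [f] kills
   the relators. *)
Definition pres_lift (x : pres) : H := eval_word (repr x).

Hypothesis fR : forall r, R r -> eval_word r = 1.

Lemma eval_word_eq u v : pres_eq R u v -> eval_word u = eval_word v.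
Proof.
elim=> {u v} [u | u v _ -> | u v w _ -> _ -> | u u' v v' _ hu _ hv | l | r hr] //.
- by move: hu hv; rewrite /eval_word !big_cat /= => -> ->.
- case: l => s []; rewrite /eval_word !big_cons !big_nil /eval_letter /= mulg1.
    by rewrite mulVg.
  by rewrite mulgV.
- by rewrite (fR hr) /eval_word big_nil.
Qed.

Lemma pres_lift_pi w : pres_lift (\pi_pres w) = eval_word w.
Proof. exact/eval_word_eq/pres_repr. Qed.

Lemma pres_lift_gen s : pres_lift (pres_gen s) = f s.
Proof. by rewrite pres_lift_pi /eval_word big_cons big_nil mulg1. Qed.

Lemma pres_liftM : {morph pres_lift : x y / x * y}.
Proof.
move=> x y; rewrite -(reprK x) -(reprK y).
rewrite (_ : \pi_pres (repr x) * \pi_pres (repr y) =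
             \pi_pres (repr x ++ repr y)); last exact: pres_mul_pi.
by rewrite !pres_lift_pi /eval_word big_cat.
Qed.

Lemma pres_lift1 : pres_lift 1 = 1.
Proof. by rewrite pres_lift_pi /eval_word big_nil. Qed.

End Lift.
End Presentation.

(* The library's ['GL_n[K]] is restricted to finite rings [K]. *)
Record glmx (K : comUnitRingType) (n : nat) :=
  GLmx { glmx_val :> 'M[K]_n; _ : glmx_val \in unitmx }.

Section GeneralLinear.
Variables (K : comUnitRingType) (n : nat).

HB.instance Definition _ := [isSub for @glmx_val K n].
HB.instance Definition _ := [Choice of glmx K n by <:].

Lemma glmxP (M : glmx K n) : (M : 'M_n) \in unitmx.
Proof. exact: valP M. Qed.

Lemma glmx_mul_subproof (M N : glmx K n) : (M *m N)%R \in unitmx.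
Proof. by rewrite unitmx_mul !glmxP. Qed.

Lemma glmx_inv_subproof (M : glmx K n) : invmx M \in unitmx.
Proof. by rewrite unitmx_inv glmxP. Qed.

Definition glmx_one : glmx K n := GLmx (unitmx1 K n).
Definition glmx_mul (M N : glmx K n) : glmx K n := GLmx (glmx_mul_subproof M N).
Definition glmx_inv (M : glmx K n) : glmx K n := GLmx (glmx_inv_subproof M).

Lemma glmx_mulA : associative glmx_mul.
Proof. by move=> M N P; apply: val_inj; rewrite /= mulmxA. Qed.

Lemma glmx_mul1 : left_id glmx_one glmx_mul.
Proof. by move=> M; apply: val_inj; rewrite /= mul1mx. Qed.

Lemma glmx_mulr1 : right_id glmx_one glmx_mul.
Proof. by move=> M; apply: val_inj; rewrite /= mulmx1. Qed.

Lemma glmx_mulV : left_inverse glmx_one glmx_inv glmx_mul.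
Proof. by move=> M; apply: val_inj; rewrite /= mulVmx ?glmxP. Qed.

Lemma glmx_mulrV : right_inverse glmx_one glmx_inv glmx_mul.
Proof. by move=> M; apply: val_inj; rewrite /= mulmxV ?glmxP. Qed.

HB.instance Definition _ := isGroup.Build (glmx K n)
  glmx_mulA glmx_mul1 glmx_mulr1 glmx_mulV glmx_mulrV.

End GeneralLinear.

Record zmod_action (G : groupType) (V : zmodType) := ZmodAction {
  zact :> G -> V -> V;
  zact1 : forall v, zact 1 v = v;
  zactM : forall g h v, zact (g * h) v = zact g (zact h v);
  zactD : forall g v w, zact g (v + w)%R = (zact g v + zact g w)%R
}.

Definition sdprod (G : groupType) (V : zmodType) (th : zmod_action G V) : Type :=
  (V * G)%type.

Section Semidirect.
Variables (G : groupType) (V : zmodType) (th : zmod_action G V).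

HB.instance Definition _ := Choice.copy (sdprod th) (V * G)%type.

Lemma zact0 g : th g 0%R = 0%R.
Proof. by apply: (addIr (th g 0%R)); rewrite -zactD !add0r. Qed.

Lemma zactN g v : th g (- v)%R = (- th g v)%R.
Proof. by apply: (addIr (th g v)); rewrite -zactD !addNr zact0. Qed.

Definition sd_one : sdprod th := (0%R, 1).
Definition sd_mul (x y : sdprod th) : sdprod th :=
  ((x.1 + th x.2 y.1)%R, x.2 * y.2).
Definition sd_inv (x : sdprod th) : sdprod th :=
  ((- th (x.2^-1)%g x.1)%R, x.2^-1).

Lemma sd_mulA : associative sd_mul.
Proof.
by move=> x y z; rewrite /sd_mul /= zactD zactM addrA mulgA.
Qed.

Lemma sd_mul1 : left_id sd_one sd_mul.
Proof. by case=> v g; rewrite /sd_mul /= zact1 add0r mul1g. Qed.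

Lemma sd_mulr1 : right_id sd_one sd_mul.
Proof. by case=> v g; rewrite /sd_mul /= zact0 addr0 mulg1. Qed.

Lemma sd_mulV : left_inverse sd_one sd_inv sd_mul.
Proof. by case=> v g; rewrite /sd_mul /= addNr mulVg. Qed.

Lemma sd_mulrV : right_inverse sd_one sd_inv sd_mul.
Proof.
by case=> v g; rewrite /sd_mul /= zactN -zactM mulgV zact1 addrN.
Qed.

HB.instance Definition _ := isGroup.Build (sdprod th)
  sd_mulA sd_mul1 sd_mulr1 sd_mulV sd_mulrV.

Definition sd_inl (v : V) : sdprod th := (v, 1).
Definition sd_inr (g : G) : sdprod th := (0%R, g).

Lemma sd_conj g v : sd_inr g * sd_inl v * (sd_inr g)^-1 = sd_inl (th g v).
Proof.
rewrite /sd_inr /sd_inl; congr pair => /=.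
  by rewrite add0r zact0 oppr0 zact0 addr0.
by rewrite mulg1 mulgV.
Qed.

End Semidirect.

Definition isomorphic (G H : groupType) : Prop :=
  exists f : {multiplicative G -> H}, bijective f.

Definition gen_a : bool := true.
Definition gen_b : bool := false.

Definition G2_relator : word bool :=
  [:: (gen_a, false); (gen_b, false); (gen_a, true); (gen_b, false)].

Definition G2 := pres (fun w : word bool => w = G2_relator).

Definition G2_a : G2 := pres_gen _ gen_a.
Definition G2_b : G2 := pres_gen _ gen_b.

Lemma G2_rel : G2_a * G2_b * G2_a^-1 * G2_b = 1.
Proof.
have -> : G2_a^-1 = \pi_G2 [:: (gen_a, true)].
  apply: (@mulgI _ G2_a); rewrite mulgV; apply/esym.
  rewrite [LHS]pres_mul_pi; apply/pres_piP; exact: pres_eq_cancel (gen_a, false).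
rewrite [G2_a * _]pres_mul_pi [X in X * _ = _]pres_mul_pi [LHS]pres_mul_pi.
by apply/pres_piP/pres_eq_rel.
Qed.

Definition mx2 (rows : seq (seq int)) : 'M[int]_2 :=
  \matrix_(i < 2, j < 2) nth 0%R (nth [::] rows i) j.

Definition mxA : 'M[int]_2 := mx2 [:: [:: 0; 1]; [:: 1; 0]]%R.
Definition mxB (k : int) : 'M[int]_2 := mx2 [:: [:: 0; 1]; [:: -1; k]]%R.

Lemma mx2_mul (a b c d a' b' c' d' : int) :
  (mx2 [:: [:: a; b]; [:: c; d]] *m mx2 [:: [:: a'; b']; [:: c'; d']] =
   mx2 [:: [:: a * a' + b * c'; a * b' + b * d'];
           [:: c * a' + d * c'; c * b' + d * d']])%R.
Proof.
apply/matrixP => i j; rewrite !mxE !big_ord_recr big_ord0 /= !mxE add0r /=.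
by case: i => [[|[|//]] ?]; case: j => [[|[|//]] ?].
Qed.

Lemma mx2_1 : mx2 [:: [:: 1; 0]; [:: 0; 1]]%R = (1%:M)%R.
Proof.
apply/matrixP => i j; rewrite !mxE.
by case: i => [[|[|//]] ?]; case: j => [[|[|//]] ?].
Qed.

Lemma mxA_unit : mxA \in unitmx.
Proof.
have h : (mxA *m mxA)%R = (1%:M)%R.
  by rewrite mx2_mul -mx2_1.
by have [] := mulmx1_unit h.
Qed.

Lemma mxB_unit k : mxB k \in unitmx.
Proof.
have h : (mxB k *m mx2 [:: [:: k; -1]; [:: 1; 0]])%R = (1%:M)%R.
  rewrite mx2_mul -mx2_1.
  by rewrite !(mul0r, mulr0, mulr1, mul1r, mulN1r, add0r, addr0, opprK, addNr).
by have [] := mulmx1_unit h.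
Qed.

Lemma mxAB_rel k : (mxA *m mxB k *m mxA *m mxB k)%R = (1%:M)%R.
Proof.
rewrite !mx2_mul -mx2_1.
by rewrite !(mul0r, mulr0, mulr1, mul1r, mulN1r, add0r, addr0, opprK, addNr,
  addrN, mulrN1).
Qed.

Definition G2_gen_mx (k : int) (s : bool) : glmx int 2 :=
  if s == gen_a then GLmx mxA_unit else GLmx (mxB_unit k).

Lemma G2_relator_mx k :
  forall r, r = G2_relator -> eval_word (G2_gen_mx k) r = 1.
Proof.
move=> _ ->; rewrite /eval_word !big_cons big_nil mulg1 /eval_letter /=.
rewrite /G2_gen_mx /=.
set a := GLmx mxA_unit; set b := GLmx _.
have aa : a * a = 1 by apply: val_inj; rewrite /= mx2_mul -mx2_1.
have -> : a^-1 = a by rewrite -[LHS]mulg1 -aa mulgA mulVg mul1g.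
by apply: val_inj; rewrite !mulgA; apply: mxAB_rel.
Qed.

Definition G2_rep (k : int) : G2 -> glmx int 2 := pres_lift (G2_gen_mx k).

Lemma G2_repM k : {morph G2_rep k : x y / x * y}.
Proof. exact: pres_liftM (G2_relator_mx k). Qed.

Lemma G2_rep1 k : G2_rep k 1 = 1.
Proof. exact: pres_lift1 (G2_relator_mx k). Qed.

Definition G2_act_fun (k : int) (g : G2) (v : 'cV[int]_2) : 'cV[int]_2 :=
  (G2_rep k g *m v)%R.

Lemma G2_act1 k v : G2_act_fun k 1 v = v.
Proof. by rewrite /G2_act_fun G2_rep1 mul1mx. Qed.

Lemma G2_actM k g h v :
  G2_act_fun k (g * h) v = G2_act_fun k g (G2_act_fun k h v).
Proof. by rewrite /G2_act_fun G2_repM mulmxA. Qed.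

Lemma G2_actD k g v w :
  G2_act_fun k g (v + w)%R = (G2_act_fun k g v + G2_act_fun k g w)%R.
Proof. exact: mulmxDr. Qed.

Definition G2_act (k : int) : zmod_action G2 'cV[int]_2 :=
  ZmodAction (G2_act1 k) (G2_actM k) (G2_actD k).

Lemma G2_act_a k v : G2_act k G2_a v = (mxA *m v)%R.
Proof. by rewrite /= /G2_act_fun /G2_rep (pres_lift_gen (G2_relator_mx k)). Qed.

Lemma G2_act_b k v : G2_act k G2_b v = (mxB k *m v)%R.
Proof. by rewrite /= /G2_act_fun /G2_rep (pres_lift_gen (G2_relator_mx k)). Qed.

Definition Hgroup (k : int) : groupType := sdprod (G2_act k).

(* Main.v *)
(* For odd k = 2m + 3 the derived subgroup of H_k is Z^2 x| <b^2>, since the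
   abelianization of Z^2 x| G_2 kills Z^2 and [a, b] = b^2.  The second derived
   subgroup is then (B_k^2 - 1) Z^2, so that the torsion subgroup of H_k'/H_k''
   is Z^2 / (B_k^2 - 1) Z^2.  Its exponent is k^2 - 4 = |det (B_k^2 - 1)|, and
   this number determines k. *)

From HB Require Import structures.
Require Import Defs.
From mathcomp Require Import all_boot all_order all_algebra.
From mathcomp Require Import boolp classical_sets cardinality.
From mathcomp Require Import ring zify.

Set Implicit Arguments.
Unset Strict Implicit.
Unset Printing Implicit Defensive.

Import Order.TTheory GRing.Theory Num.Theory.

Local Open Scope classical_set_scope.
Local Open Scope quotient_scope.
Local Open Scope group_scope.

(** * Subgroups, derived subgroups and cyclic subgroups *)

Record is_subgroup (G : groupType) (P : set G) : Prop := IsSubgroup {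
  subgroup1 : P 1;
  subgroupM : forall x y, P x -> P y -> P (x * y);
  subgroupV : forall x, P x -> P x^-1
}.

(** Taking the intersection of all subgroups that contain the commutators makes membership its own
    elimination principle. *)
Definition derived (G : groupType) (P : set G) : set G := fun x =>
  forall Q : set G, is_subgroup Q ->
    (forall y z, P y -> P z -> Q [~ y, z]) -> Q x.

Lemma commMgJ (G : groupType) (x y z : G) : [~ x * y, z] = [~ x, z] ^ y * [~ y, z].
Proof. by rewrite !commgEr conjgM conjMg -!mulgA !mulVKg. Qed.

Lemma commVgJ (G : groupType) (x y : G) : [~ x^-1, y] = [~ x, y]^-1 ^ x^-1.
Proof. by rewrite invgR !commgEl !conjgE !invgK -!mulgA mulgV mulg1. Qed.

Section Subgroups.
Variables (G : groupType).
Implicit Types (P Q : set G) (x y z : G).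

Lemma subgroupX P x n : is_subgroup P -> P x -> P (x ^+ n).
Proof.
move=> sP Px; elim: n => [|n IHn]; first exact: subgroup1.
by rewrite expgS; apply: subgroupM.
Qed.

Lemma derived_subgroup P : is_subgroup (derived P).
Proof.
split=> [|x y Px Py|x Px] Q sQ PQ; first exact: subgroup1.
- by apply: subgroupM => //; [apply: Px | apply: Py].
- by apply: subgroupV => //; apply: Px.
Qed.

Lemma derived_commg P x y : P x -> P y -> derived P [~ x, y].
Proof. by move=> Px Py Q _; apply. Qed.

Definition powers z : set G := fun x => exists m n, x = z ^+ m / z ^+ n.

Lemma powers_subgroup z : is_subgroup (powers z).
Proof.
have cX m n : commute (z ^+ m) (z ^+ n) by exact/commuteX2/commute_refl.
split; first by exists 0, 0; rewrite mulgV.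
- move=> _ _ [m [n ->]] [p [q ->]]; exists (m + p)%N, (q + n)%N.
  rewrite !expgnDr invgM !mulgA; congr (_ / _).
  rewrite -!mulgA; congr (_ * _).
  exact/commute_sym/commuteV.
- by move=> _ [m [n ->]]; exists n, m; rewrite invgF.
Qed.

Lemma powers_id z : powers z z.
Proof. by exists 1%N, 0%N; rewrite divg1. Qed.

Lemma powers_min P z x : is_subgroup P -> P z -> powers z x -> P x.
Proof.
by move=> sP Pz [m [n ->]]; apply: subgroupM => //; [|apply: subgroupV => //]; apply: subgroupX.
Qed.

(** Centralizers are subgroups, so minimality of <z> applies twice: z commutes with x, hence x
    commutes with y. *)
Lemma powers_commute z x y : powers z x -> powers z y -> commute x y.
Proof.
have cent (u : G) : is_subgroup (fun v => commute u v).
  by split; [apply: commute1 | apply: commuteM | apply: commuteV].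
move=> zx zy; apply: (powers_min (cent x) _ zy); apply: commute_sym.
by apply: (powers_min (cent z) _ zx); apply: commute_refl.
Qed.

Lemma powers_conjg z w x :
  powers z (z ^ w) -> powers z x -> powers z (x ^ w).
Proof.
have sN := powers_subgroup z.
move=> zw; apply: (@powers_min (fun y => powers z (y ^ w))) => //.
split; rewrite ?conj1g; first exact: subgroup1.
- by move=> x1 x2 ? ?; rewrite conjMg; apply: subgroupM.
- by move=> x1 ?; rewrite conjVg; apply: subgroupV.
Qed.

End Subgroups.

Section Multiplicative.
Variables (G H : groupType) (f : {multiplicative G -> H}).

Lemma multiplicative1 : f 1 = 1.
Proof. by apply: (mulgI (f 1)); rewrite -gmulfM !mulg1. Qed.

Lemma multiplicativeV x : f x^-1 = (f x)^-1.
Proof. by apply: (mulgI (f x)); rewrite -gmulfM !mulgV multiplicative1. Qed.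

Lemma multiplicativeX x n : f (x ^+ n) = f x ^+ n.
Proof. by elim: n => [|n IHn]; rewrite ?multiplicative1 // !expgS gmulfM IHn. Qed.

End Multiplicative.

(** The preimage under f of the derived subgroup of Q is a subgroup containing the commutators of
    P. *)
Lemma derived_morph (G H : groupType) (f : {multiplicative G -> H})
    (P : set G) (Q : set H) :
  (forall x, P x -> Q (f x)) -> forall x, derived P x -> derived Q (f x).
Proof.
move=> PQ x Dx; apply: (Dx (fun y => derived Q (f y))).
  case: (derived_subgroup Q) => d1 dM dV.
  by split=> [|y z|y]; rewrite ?multiplicative1 ?gmulfM ?multiplicativeV; [|apply: dM|apply: dV].
move=> y z Py Pz; rewrite !gmulfM !multiplicativeV.
by apply: derived_commg; apply: PQ.
Qed.

(** * Commutators in G_2 and the subgroup <b^2> *)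

Lemma pres_gen_ind (S : choiceType) (R : word S -> Prop) (P : set (pres R)) :
  is_subgroup P -> (forall s, P (pres_gen R s)) -> forall x, P x.
Proof.
move=> sP Pgen; elim/quotW; elim=> [|[s b] w IHw]; first exact: (subgroup1 sP).
rewrite -cat1s -pres_mul_pi; apply: (subgroupM sP) => //.
case: b; last exact: Pgen.
suff E : \pi_(pres R) [:: (s, true)] = (pres_gen R s)^-1.
  by have := subgroupV sP (Pgen s); rewrite -E.
apply: (@mulgI _ (pres_gen R s)); rewrite mulgV [LHS]pres_mul_pi.
exact/pres_piP/(pres_eq_cancel R (s, false)).
Qed.

Lemma G2_ind (P : set G2) :
  is_subgroup P -> P G2_a -> P G2_b -> forall x, P x.
Proof. by move=> sP Pa Pb; apply: pres_gen_ind => // -[]. Qed.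

Definition G2_z : G2 := G2_b * G2_b.

Lemma G2_conj_ab : G2_b ^ G2_a^-1 = G2_b^-1.
Proof.
apply: (mulIg G2_b); rewrite mulVg conjgE invgK mulgA.
exact: G2_rel.
Qed.

Lemma G2_conj_ba : G2_b ^ G2_a = G2_b^-1.
Proof. by apply: invg_inj; rewrite [RHS]invgK -conjVg -G2_conj_ab conjgKV. Qed.

Lemma G2_z_commg : [~ G2_a, G2_b] = G2_z.
Proof. by rewrite -invgR commgEl G2_conj_ba /G2_z invgM invgK. Qed.

Lemma G2_powers_conjg x g : powers G2_z x -> powers G2_z (x ^ g).
Proof.
have sN := powers_subgroup G2_z.
(* The induction carries g and its inverse together: z ^ g in <z> alone does not formally pass to
   g^-1. *)
suff [+ _] : powers G2_z (G2_z ^ g) /\ powers G2_z (G2_z ^ g^-1).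
  exact: powers_conjg.
have NzV : powers G2_z G2_z^-1 by apply/(subgroupV sN)/powers_id.
have inv_conj : G2_b^-1 * G2_b^-1 = G2_z^-1 by rewrite /G2_z invgM.
have zb : commute G2_z G2_b by rewrite /commute /G2_z mulgA.
apply: (G2_ind (P := fun g =>
  powers G2_z (G2_z ^ g) /\ powers G2_z (G2_z ^ g^-1))).
- split; rewrite ?invg1 ?conjg1; first by split; apply: powers_id.
  + move=> g1 g2 [h1 h1'] [h2 h2']; rewrite invgM !conjgM.
    by split; apply: powers_conjg.
  + by move=> g1 [? ?]; rewrite invgK.
- by rewrite {2 4}/G2_z !conjMg G2_conj_ab G2_conj_ba inv_conj.
- have zfix u : commute G2_z u -> G2_z ^ u = G2_z by move=> ?; apply/conjg_fixP/commgP.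
  by rewrite !zfix //; [split; apply: powers_id | apply: commuteV].
Qed.

(** The generators commute modulo <z>. As <z> is normal, the v with [v, u] in <z> form a subgroup
    for each u, so both arguments reduce to generators. *)
Lemma G2_commg_powers g h : powers G2_z [~ g, h].
Proof.
have sN := powers_subgroup G2_z.
have sub_comm (u : G2) : is_subgroup (fun v => powers G2_z [~ v, u]).
  split=> [|x y Nx Ny|x Nx]; first by rewrite comm1g; apply: (subgroup1 sN).
  - by rewrite commMgJ; apply: (subgroupM sN) => //; apply: G2_powers_conjg.
  - by rewrite commVgJ; apply/G2_powers_conjg/(subgroupV sN).
have comm_sym x y : powers G2_z [~ x, y] -> powers G2_z [~ y, x].
  by rewrite -[in X in _ -> X]invgR; apply: (subgroupV sN).
have N1 : powers G2_z 1 by apply: (subgroup1 sN).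
have Na x : powers G2_z [~ x, G2_a].
  apply: (G2_ind (sub_comm G2_a)); rewrite ?commgg //.
  by apply: comm_sym; rewrite G2_z_commg; apply: powers_id.
have Nb x : powers G2_z [~ x, G2_b].
  apply: (G2_ind (sub_comm G2_b)); rewrite ?commgg //.
  by rewrite G2_z_commg; apply: powers_id.
apply: (G2_ind (sub_comm h)); exact: comm_sym.
Qed.

(* B_2 is unipotent, hence of infinite order: the case k = 2 shows that b has
   infinite order in G_2. *)
Lemma G2_rep2_zX n :
  G2_rep 2 (G2_z ^+ n) = mx2 [:: [:: 1 - (2 * n)%:Z; (2 * n)%:Z];
                              [:: - (2 * n)%:Z; 1 + (2 * n)%:Z]]%R :> 'M_2.
Proof.
have rep_b : G2_rep 2 G2_b = mxB 2 :> 'M_2.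
  by rewrite /G2_rep (pres_lift_gen (G2_relator_mx 2)).
elim: n => [|n IHn].
  rewrite G2_rep1 /= -mx2_1 muln0.
  by congr mx2; rewrite subr0 addr0 oppr0.
rewrite expgSr /G2_z !G2_repM /= IHn rep_b /mxB !mx2_mul.
by congr mx2; congr [:: [:: _; _]; [:: _; _]]; lia.
Qed.

Lemma G2_zX_inj : injective (fun n => G2_z ^+ n).
Proof.
move=> m n /(congr1 (fun g => (G2_rep 2 g : 'M_2) 0%R 1%R)).
rewrite !G2_rep2_zX !mxE /=; lia.
Qed.

(** If z^p / z^q has n-th power 1, then p n = q n because distinct powers of z differ. *)
Lemma G2_powers_torsion_free g n : powers G2_z g -> 0 < n -> g ^+ n = 1 -> g = 1.
Proof.
move=> [p [q ->]] n_gt0.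
rewrite expgnFl; last exact/commuteX2/commute_refl.
rewrite -!expgnA => /divg1_eq /G2_zX_inj /eqP.
by rewrite eqn_pmul2r // => /eqP ->; rewrite mulgV.
Qed.

(** * The derived series of a semidirect product *)

Section SemidirectDerived.
Variables (G : groupType) (V : zmodType) (th : zmod_action G V) (z : G).
Implicit Types (g h : G) (v w : V) (x y : sdprod th).

Definition moved : set V := fun v => exists w, v = (th z w - w)%R.

Lemma sd_mulE x y : x * y = ((x.1 + th x.2 y.1)%R, x.2 * y.2) :> sdprod th.
Proof. by []. Qed.

Lemma sd_invE x : x^-1 = ((- th x.2^-1%g x.1)%R, x.2^-1) :> sdprod th.
Proof. by []. Qed.

Lemma sd_inlD v w : sd_inl th (v + w)%R = sd_inl th v * sd_inl th w :> sdprod th.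
Proof. by rewrite sd_mulE /= zact1 mulg1. Qed.

Lemma sd_inlX v n : (sd_inl th v : sdprod th) ^+ n = sd_inl th (v *+ n)%R.
Proof. by elim: n => [|n IHn] //; rewrite expgS IHn mulrS sd_inlD. Qed.

Lemma sd_sndX x n : (x ^+ n).2 = x.2 ^+ n.
Proof. by elim: n => [|n IHn] //; rewrite !expgS sd_mulE /= IHn. Qed.

Lemma movedD v w : moved v -> moved w -> moved (v + w)%R.
Proof.
by move=> [v' ->] [w' ->]; exists (v' + w')%R; rewrite zactD opprD addrACA.
Qed.

Lemma movedN v : moved v -> moved (- v)%R.
Proof. by move=> [w ->]; exists (- w)%R; rewrite zactN opprD. Qed.

Lemma moved_zact g v : commute g z -> moved v -> moved (th g v).
Proof.
move=> gz [w ->]; exists (th g w).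
by rewrite -zactM -gz zactM zactD zactN.
Qed.

(** The identities gh - 1 = (g - 1) h + (h - 1) and g^-1 - 1 = - (g - 1) g^-1 reduce the claim to g
    = z. *)
Lemma moved_powers g v : powers z g -> moved (th g v - v)%R.
Proof.
move=> zg; move: v; apply: (powers_min (P := fun g => forall v, moved (th g v - v)%R) _ _ zg).
  split=> [v|h k IHh IHk v|h IHh v].
  - by exists 0%R; rewrite zact0 subr0 zact1 subrr.
  - rewrite zactM -(subrK (th k v) (th h _)) -addrA.
    exact: movedD.
  - have := movedN (IHh (th h^-1 v)).
    by rewrite -zactM mulgV zact1 opprB.
by move=> v; exists v.
Qed.

Lemma sd_derived_snd : (forall g h, powers z [~ g, h]) ->
  forall x, derived [set: sdprod th] x -> powers z x.2.
Proof.
move=> Gz x Dx; apply: (Dx (fun x => powers z x.2)) => [|y t _ _]; last exact: Gz.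
have sN := powers_subgroup z.
split=> [|y t|y]; [exact: subgroup1 | exact: subgroupM | exact: subgroupV].
Qed.

(** Here [x, y] = (y x)^-1 (x y), and x y and y x have the same G-component, so only a vector
    remains. *)
Lemma sd_commgE x y : commute x.2 y.2 ->
  [~ x, y] = sd_inl th (th ((y.2 * x.2)^-1)%g
    ((th x.2 y.1 - y.1) - (th y.2 x.1 - x.1)))%R.
Proof.
move=> cxy; rewrite commgEl conjgE mulgA -invgM !sd_mulE sd_invE /=.
congr pair; last by rewrite cxy mulVg.
rewrite /= -zactN -zactD; congr (th _ _).
by rewrite opprD opprB addrC (addrC x.1) addrACA.
Qed.

(** Elements of the derived subgroup have G-components in the abelian group <z>. By [sd_commgE]
    their commutators are differences of vectors in (z - 1) V, moved by an element of <z>, which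
    preserves (z - 1) V. *)
Lemma sd_derived2 : (forall g h, powers z [~ g, h]) ->
  forall x, derived (derived [set: sdprod th]) x ->
  exists2 v, moved v & x = sd_inl th v.
Proof.
move=> Gz x Dx.
apply: (Dx (fun x => exists2 v, moved v & x = sd_inl th v)) => [|y t Dy Dt].
  split=> [|_ _ [v Mv ->] [w Mw ->]|_ [v Mv ->]].
  - by exists 0%R => //; exists 0%R; rewrite zact0 subr0.
  - by exists (v + w)%R; [exact: movedD | rewrite sd_inlD].
  - exists (- v)%R; first exact: movedN.
    by rewrite sd_invE /= invg1 zact1.
have Py := sd_derived_snd Gz Dy; have Pt := sd_derived_snd Gz Dt.
have sN := powers_subgroup z.
rewrite sd_commgE; last exact: powers_commute Py Pt.
eexists; last by [].
apply: moved_zact; last by apply: movedD; [|apply: movedN]; apply: moved_powers.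
by apply: (powers_commute (z := z)); [apply/(subgroupV sN)/(subgroupM sN) | apply: powers_id].
Qed.

(** Since [x, y] is x^-1 y^-1 x y, the inverses turn it into g v g^-1 v^-1, where g v g^-1 is the
    action of g on v. *)
Lemma sd_inlBE g v :
  sd_inl th (th g v - v)%R = [~ (sd_inr th g)^-1, (sd_inl th v)^-1] :> sdprod th.
Proof.
rewrite /commg /conjg !invgK mulgA mulgA sd_conj sd_mulE /= /sd_inl /=.
by rewrite zact1 invg1 zact1 mulg1.
Qed.

Lemma sd_inrR g h : sd_inr th [~ g, h] = [~ sd_inr th g, sd_inr th h] :> sdprod th.
Proof.
have inrM (u v : G) : sd_inr th (u * v) = sd_inr th u * sd_inr th v :> sdprod th.
  by rewrite sd_mulE /= zact0 addr0.
have inrV (u : G) : sd_inr th u^-1 = (sd_inr th u)^-1 :> sdprod th.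
  by rewrite sd_invE /= zact0 oppr0.
by rewrite /commg /conjg !inrM !inrV.
Qed.

Lemma sd_derived_inl g v :
  derived [set: sdprod th] (sd_inl th (th g v - v)%R).
Proof. by rewrite sd_inlBE; apply: derived_commg. Qed.

(** A converse to [sd_derived2]: (z - 1) w is a commutator of elements lying over z^-1 and in V. *)
Lemma sd_derived2_moved v :
  (forall w, derived [set: sdprod th] (sd_inl th w)) ->
  derived [set: sdprod th] (sd_inr th z) ->
  moved v -> derived (derived [set: sdprod th]) (sd_inl th v).
Proof.
move=> DV Dz [w ->]; rewrite sd_inlBE.
by apply: derived_commg; apply: (subgroupV (derived_subgroup _)).
Qed.

End SemidirectDerived.

(** * The action on Z^2 in coordinates *)

Definition cv2 (p q : int) : 'cV[int]_2 := (\col_i nth 0 [:: p; q] i)%R.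

Lemma cv2E (v : 'cV[int]_2) : v = cv2 (v 0 0)%R (v 1 0)%R.
Proof.
apply/colP => i; rewrite mxE; case: i => [[|[|//]] ?] /=.
  by congr (v _ _); apply: val_inj.
by congr (v _ _); apply: val_inj.
Qed.

Lemma cv2D p q p' q' : (cv2 p q + cv2 p' q' = cv2 (p + p') (q + q'))%R.
Proof. by apply/colP => -[[|[|//]] ?]; rewrite !mxE. Qed.

Lemma cv2N p q : (- cv2 p q = cv2 (- p) (- q))%R.
Proof. by apply/colP => -[[|[|//]] ?]; rewrite !mxE. Qed.

Lemma cv2Mn p q n : (cv2 p q *+ n = cv2 (p * n%:Z) (q * n%:Z))%R.
Proof.
by apply/colP => -[[|[|//]] ?]; rewrite mulmxnE !mxE /= -mulr_natr natz.
Qed.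

Lemma cv2_inj p q p' q' : cv2 p q = cv2 p' q' -> p = p' /\ q = q'.
Proof.
move=> h; have := congr1 (fun v : 'cV[int]_2 => v 0 0)%R h.
by have := congr1 (fun v : 'cV[int]_2 => v 1 0)%R h; rewrite !mxE.
Qed.

Lemma act_a_cv2 k p q : G2_act k G2_a (cv2 p q) = cv2 q p.
Proof.
rewrite G2_act_a; apply/colP => -[[|[|//]] ?];
  by rewrite !mxE !big_ord_recr big_ord0 /= !mxE /=; ring.
Qed.

Lemma act_b_cv2 k p q : G2_act k G2_b (cv2 p q) = cv2 q (k * q - p)%R.
Proof.
rewrite G2_act_b; apply/colP => -[[|[|//]] ?];
  by rewrite !mxE !big_ord_recr big_ord0 /= !mxE /=; ring.
Qed.

Lemma movedP k p q : moved (G2_act k) G2_z (cv2 p q) <->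
  exists x y, (p = k * y - 2 * x /\ q = k * (k * y - x) - 2 * y)%R.
Proof.
have zE x y : (G2_act k G2_z (cv2 x y) - cv2 x y =
    cv2 (k * y - 2 * x) (k * (k * y - x) - 2 * y))%R.
  by rewrite zactM !act_b_cv2 cv2N cv2D; congr cv2; ring.
split=> [[w]|[x [y [-> ->]]]]; last by exists (cv2 x y); rewrite zE.
by rewrite (cv2E w) zE => /cv2_inj ?; do 2!eexists; eassumption.
Qed.

(** * The derived series of H_k for odd k, and the invariant k^2 - 4 *)

Definition odd_param (m : nat) : int := ((2 * m + 3)%N%:Z)%R.
(** Expanded to avoid subtraction in [nat]. As k = 2 m + 3 is at least 3, the value is positive and
    strictly increasing in m. *)
Definition disc (m : nat) : nat := (4 * m ^ 2 + 12 * m + 5)%N.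

Lemma discE m : ((disc m)%:Z = odd_param m ^+ 2 - 4)%R.
Proof. rewrite /disc /odd_param; lia. Qed.

(** The coordinate sum identifies Z^2 / (A - 1) Z^2 with Z, and (B - 1)(p, q) has coordinate sum k q
    - 2 p, which takes every integer value when k is odd. *)
Lemma Hgroup_derived_inl m v :
  derived [set: Hgroup (odd_param m)] (sd_inl _ v).
Proof.
rewrite (cv2E v); set p := v _ _; set q := v _ _.
(* e1 = (B - 1)(M, 1) - (A - 1)(M, 0) with k = 2 M + 1, and e2 = e1 + (A - 1) e1. *)
set M : int := (m.+1%:Z)%R.
have -> : cv2 p q =
    (G2_act (odd_param m) G2_b (cv2 (M * (p + q)) (p + q)) - cv2 (M * (p + q)) (p + q)
     + (G2_act (odd_param m) G2_a (cv2 (q - M * (p + q)) 0) - cv2 (q - M * (p + q)) 0))%R.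
  rewrite act_a_cv2 act_b_cv2 !cv2N !cv2D.
  have -> : odd_param m = (2 * M + 1)%R by rewrite /odd_param /M; lia.
  by congr cv2; ring.
rewrite sd_inlD; apply: (subgroupM (derived_subgroup _)); apply: sd_derived_inl.
Qed.

Lemma Hgroup_derived2 m v :
  moved (G2_act (odd_param m)) G2_z v <->
  derived (derived [set: Hgroup (odd_param m)]) (sd_inl _ v).
Proof.
split=> [|Dv].
  apply: sd_derived2_moved; first exact: Hgroup_derived_inl.
  by rewrite -G2_z_commg sd_inrR; apply: derived_commg.
by have [w Mw [->]] := sd_derived2 G2_commg_powers Dv.
Qed.

Lemma moved_disc m v : moved (G2_act (odd_param m)) G2_z (v *+ disc m)%R.
Proof.
rewrite (cv2E v) cv2Mn; set p := v _ _; set q := v _ _; set k := odd_param m.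
(* Minus the adjugate of B^2 - 1 = [[-2, k], [-k, k^2 - 2]], applied to (p, q). *)
apply/movedP; exists (k * q - (k ^+ 2 - 2) * p)%R, (2 * q - k * p)%R.
by rewrite discE -/k; split; ring.
Qed.

(** Together with [moved_disc], this shows that the first basis vector has order exactly k^2 - 4
    modulo (B^2 - 1) Z^2. *)
Lemma moved_e1_disc m n :
  moved (G2_act (odd_param m)) G2_z (cv2 1 0 *+ n)%R -> disc m %| n.
Proof.
rewrite cv2Mn => /movedP[x [y]]; rewrite mul1r mul0r => -[nE yE].
set k := odd_param m in nE yE.
(* Subtracting twice [yE] from k times [nE] eliminates x. *)
have kn : (k * n%:Z = (4 - k ^+ 2) * y)%R.
  rewrite nE; apply/eqP; rewrite -subr_eq0; apply/eqP.
  by rewrite -[RHS](mulr0 (2 : int)%R) yE; ring.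
suff : (disc m %| n%:Z)%Z by rewrite dvdzE.
(* Since k is odd, k^2 - 4 = 4 r + 1 is prime to 4, while it divides
   k^2 n = (k^2 - 4) n + 4 n. *)
pose r : int := (m%:Z ^+ 2 + 3 * m%:Z + 1)%R.
apply/dvdzP; exists (n%:Z + r * (k * y + n%:Z))%R; rewrite discE -/k.
have -> : ((n%:Z + r * (k * y + n%:Z)) * (k ^+ 2 - 4) =
    (k ^+ 2 - 4) * n%:Z + r * ((k ^+ 2 - 4) * n%:Z - k * ((4 - k ^+ 2) * y)))%R by ring.
rewrite -kn; have -> : k = (2 * m%:Z + 3)%R by rewrite /k /odd_param; lia.
by rewrite /r; ring.
Qed.

(** The image g e is torsion modulo the second derived subgroup, hence a vector, so its multiple by
    [disc k] lies in that subgroup. Applying f carries this back to e, whose order is [disc l]. *)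
Lemma disc_dvd k l
    (f : {multiplicative Hgroup (odd_param k) -> Hgroup (odd_param l)})
    (g : {multiplicative Hgroup (odd_param l) -> Hgroup (odd_param k)}) :
  cancel g f -> disc l %| disc k.
Proof.
move=> gK; set e := sd_inl (G2_act (odd_param l)) (cv2 1 0)%R.
have De : derived setT (g e).
  by apply: (derived_morph (P := setT)) => //; apply: Hgroup_derived_inl.
have De2 : derived (derived setT) (g e ^+ disc l).
  rewrite -multiplicativeX sd_inlX; apply: (derived_morph (P := derived setT)).
    by apply: derived_morph.
  exact/Hgroup_derived2/moved_disc.
(* The G-component of g e lies in the torsion-free group <z> and has finite order. *)
have ge1 : (g e).2 = 1.
  have [v _ /(congr1 snd)] := sd_derived2 G2_commg_powers De2.
  rewrite sd_sndX => ge_tors.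
  apply: G2_powers_torsion_free ge_tors; last by rewrite /disc addn_gt0 orbT.
  exact: sd_derived_snd G2_commg_powers _ De.
have geE : g e = sd_inl _ (g e).1 by case: (g e) ge1 => v h /= ->.
apply: moved_e1_disc; apply/Hgroup_derived2.
rewrite -sd_inlX -/e -(gK e) -multiplicativeX; apply: (derived_morph (P := derived setT)).
  by apply: derived_morph.
by rewrite geE sd_inlX; apply/Hgroup_derived2/moved_disc.
Qed.

Theorem mainTheorem4 :
  exists K : set int, infinite_set K /\
    forall k l : int, K k -> K l -> k <> l -> ~ isomorphic (Hgroup k) (Hgroup l).
Proof.
exists (range odd_param); split.
  rewrite (@eq_finite_set _ _ _ [set: nat]); first exact: infinite_nat.
  by apply: inj_card_eq; apply: in2W => m n; rewrite /odd_param; lia.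
move=> _ _ [k _ <-] [l _ <-] neq [f [g fK gK]]; apply: neq.
pose g' : {multiplicative Hgroup (odd_param l) -> Hgroup (odd_param k)} := HB.pack g
  (isMultiplicative.Build _ _ g (can2_gmulfM fK gK)).
have lk := disc_dvd (f := f) (g := g') gK.
have kl := disc_dvd (f := g') (g := f) fK.
have : disc k = disc l by apply/eqP; rewrite eqn_dvd kl lk.
(* Equal values of [disc] force equal parameters, by strict monotonicity. *)
rewrite /disc /odd_param; nia.
Qed.
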